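(* If $G_1$ and $G_2$ are graphs, then $$\max\{a_1(G_1), a_1(G_2)\} \le a_1(G_1\cup G_2) \le a_1(G_1)+ a_1(G_2),$$ where $G_1\cup G_2$ denotes the disjoint union of $G_1$ and $G_2$.
   Context: All graphs are finite, simple, and have at least one vertex. The disjoint union of two (vertex-disjoint) graphs $G$ and $H$ has vertex set $V(G)\cup V(H)$ and edge set $E(G)\cup E(H)$. A clique of a graph $G$ is an inclusion-wise maximal complete subgraph (an isolated vertex is a clique of size 1). The $(a,b)$-monochromatic clique transversal game ($(a,b)$-MCT game) on $G$ is played by Alice and Bob, who alternately take turns: in each of her turns Alice chooses $a$ unplayed vertices and colors them red, and in each of his turns Bob chooses $b$ unplayed vertices and colors them blue (if fewer unplayed vertices remain, the player colors all of them). Alice wins if the red vertices contain at least one vertex of each clique of $G$; Bob wins if all vertices of some clique of $G$ are blue. The game is Alice-start if Alice moves first. The threshold $a_1(G)$ is the smallest positive integer $a$ such that Alice has a winning strategy in the Alice-start $(a,1)$-MCT game on $G$. *)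

(* Defs.v *)
From mathcomp Require Import all_boot.
From mathcomp.classical Require Import boolp.

Set Implicit Arguments.
Unset Strict Implicit.
Unset Printing Implicit Defensive.

Record sgraph := SGraph {
  vertex :> finType;
  adj : rel vertex;
  adj_sym : symmetric adj;
  adj_irr : irreflexive adj;
  vertex_gt0 : 0 < #|vertex| }.

Section DisjointUnion.
Variables G H : sgraph.

Definition dunion_adj (x y : G + H) : bool :=
  match x, y with
  | inl u, inl v => adj u v
  | inr u, inr v => adj u v
  | _, _ => false
  end.

Lemma dunion_adj_sym : symmetric dunion_adj.
Proof. by move=> [u|u] [v|v] //=; apply: adj_sym. Qed.

Lemma dunion_adj_irr : irreflexive dunion_adj.
Proof. by move=> [u|u] /=; apply: adj_irr. Qed.

Lemma dunion_gt0 : 0 < #|{: G + H}|.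
Proof. by rewrite card_sum addn_gt0 vertex_gt0. Qed.

Definition dunion : sgraph := SGraph dunion_adj_sym dunion_adj_irr dunion_gt0.

End DisjointUnion.

Section Game.
Variable G : sgraph.

Definition complete (K : {set G}) : bool :=
  [forall x in K, forall y in K, (x != y) ==> adj x y].

Definition clique (K : {set G}) : bool := maxset complete K.

Definition clique_transversal (R : {set G}) : bool :=
  [forall K : {set G}, clique K ==> (K :&: R != set0)].

(* The successive moves of an Alice-start game, most recent first, so that
   the player to move after [h] is Alice if [size h] is even, Bob otherwise. *)
Definition history := seq {set G}.

(* The vertices coloured by Alice ([bob = false]) or Bob ([bob = true]). *)
Fixpoint colored (bob : bool) (h : history) : {set G} :=
  if h is M :: h' then
    if odd (size h') == bob then M :|: colored bob h' else colored bob h'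
  else set0.

Definition red : history -> {set G} := colored false.
Definition blue : history -> {set G} := colored true.
Definition unplayed (h : history) : {set G} := ~: (red h :|: blue h).

Definition strategy := history -> {set G}.

Definition legal (k : nat) (s : strategy) : Prop :=
  forall h, s h \subset unplayed h /\ #|s h| = minn k #|unplayed h|.

Definition play (s t : strategy) (n : nat) : history :=
  iter n (fun h => (if odd (size h) then t h else s h) :: h) [::].

(* Plays are not stopped when a player wins: red and blue sets only grow and
   stay disjoint, so at most one player can ever meet the winning condition,
   and moves are empty once all vertices are coloured. *)
Definition alice_wins (s t : strategy) : Prop :=
  exists n, clique_transversal (red (play s t n)).

Definition alice_start_winning (a b : nat) : Prop :=
  exists2 s, legal a s & forall t, legal b t -> alice_wins s t.

Lemma clique_transversalT : clique_transversal setT.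
Proof.
apply/forallP => K; apply/implyP => /maxsetP[_ maxK]; rewrite setIT.
apply/eqP => K0; have [x _] := card_gt0P (vertex_gt0 G).
have cx : complete [set x].
  by do 2![apply/forall_inP => ? /set1P->]; rewrite eqxx.
have := maxK _ cx; rewrite K0 sub0set => /(_ isT) x0.
by have := set11 x; rewrite x0 inE.
Qed.

Lemma ex_winning : exists a, (0 < a) && `[< alice_start_winning a 1 >].
Proof.
exists #|G|; rewrite vertex_gt0; apply/asboolP.
exists unplayed => [h|t _].
  by split=> //; apply/esym/minn_idPr/max_card.
exists 1; suff -> : red (play unplayed t 1) = setT by apply: clique_transversalT.
by rewrite /play /= /unplayed /red /= !setU0 setC0.
Qed.

Definition a1 : nat := ex_minn ex_winning.

End Game.

(* Main.v *)
Require Import Defs.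
From mathcomp Require Import all_boot.
From mathcomp.classical Require Import boolp.

Set Implicit Arguments.
Unset Strict Implicit.
Unset Printing Implicit Defensive.

(* A winning strategy for Alice amounts to a set Q of positions (R, B), red and
   blue, with Bob to move, in which no clique is blue and to which Alice can
   always return after a move of Bob, colouring at most a vertices.  On
   a disjoint union the product of such sets Q1 and Q2 works: Alice answers in
   the component where Bob has just played, and the sum a1 G1 + a1 G2 is only
   spent on her first move.  Conversely the trace on a component of such a set
   Q is again one, obtained by letting Bob play only in that component. *)

(** * Safe regions of positions, and general facts on plays *)

Section Safety.
Variable G : sgraph.
Implicit Types (R B A K : {set G}) (h : history G) (a n : nat).

Lemma clique_neq0 K : clique K -> K != set0.
Proof.
by move=> cK; have /forallP/(_ K) := clique_transversalT G; rewrite cK setIT.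
Qed.

(** The reply [A] may overlap [R] and may have fewer than [a] vertices. This slack keeps the notion
    stable under traces and products. *)
Definition safe_region a (Q : {set G} -> {set G} -> Prop) : Prop :=
  forall R B, Q R B ->
    (forall K, clique K -> ~~ (K \subset B)) /\
    (forall m, m \notin R :|: B ->
       exists A, [/\ [disjoint A & m |: B], #|A| <= a & Q (A :|: R) (m |: B)]).

Definition safe a : Prop :=
  exists Q A, [/\ safe_region a Q, #|A| <= a & Q A set0].

Lemma redS (M : {set G}) h :
  red (M :: h) = if odd (size h) then red h else M :|: red h.
Proof. by rewrite /red /=; case: odd. Qed.

Lemma blueS (M : {set G}) h :
  blue (M :: h) = if odd (size h) then M :|: blue h else blue h.
Proof. by rewrite /blue /=; case: odd. Qed.

Lemma unplayedS (M : {set G}) h : unplayed (M :: h) = unplayed h :\: M.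
Proof.
rewrite /unplayed redS blueS setDE -setCU; congr (~: _).
by rewrite [RHS]setUC; case: odd; [rewrite setUCA | rewrite setUA].
Qed.

Lemma size_play (s t : strategy G) n : size (play s t n) = n.
Proof. by elim: n => //= n ->. Qed.

Lemma playS (s t : strategy G) n :
  play s t n.+1 =
    (if odd n then t (play s t n) else s (play s t n)) :: play s t n.
Proof. by rewrite /= -/(play s t n) size_play. Qed.

Lemma red_playS (s t : strategy G) n :
  red (play s t n.+1) =
    if odd n then red (play s t n) else s (play s t n) :|: red (play s t n).
Proof. by rewrite playS redS size_play; case: odd. Qed.

Lemma blue_playS (s t : strategy G) n :
  blue (play s t n.+1) =
    if odd n then t (play s t n) :|: blue (play s t n) else blue (play s t n).
Proof. by rewrite playS blueS size_play; case: odd. Qed.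

Lemma subset_red_play (s t : strategy G) n k :
  red (play s t n) \subset red (play s t (k + n)).
Proof.
elim: k => // k /subset_trans; apply; rewrite addSn red_playS.
by case: odd => //; apply: subsetUr.
Qed.

Lemma subset_blue_play (s t : strategy G) n k :
  blue (play s t n) \subset blue (play s t (k + n)).
Proof.
elim: k => // k /subset_trans; apply; rewrite addSn blue_playS.
by case: odd => //; apply: subsetUr.
Qed.

Lemma disjoint_play a b (s t : strategy G) n : legal a s -> legal b t ->
  [disjoint red (play s t n) & blue (play s t n)].
Proof.
move=> ls lt; elim: n => [|n IHn]; first by rewrite -setI_eq0 set0I.
have [us _] := ls (play s t n); have [ut _] := lt (play s t n).
rewrite red_playS blue_playS; case: odd.
  rewrite disjoint_sym disjoints_subset subUset -!disjoints_subset.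
  rewrite [X in _ && X]disjoint_sym IHn andbT disjoints_subset.
  by rewrite (subset_trans ut) // setCS subsetUl.
rewrite disjoints_subset subUset -!disjoints_subset IHn andbT.
by rewrite disjoints_subset (subset_trans us) // setCS subsetUr.
Qed.

(** Since [a] and [b] are positive, every move colours a vertex as long as one is left. *)
Lemma card_unplayed_play a b (s t : strategy G) n :
    0 < a -> 0 < b -> legal a s -> legal b t ->
  #|unplayed (play s t n)| <= #|G| - n.
Proof.
move=> a0 b0 ls lt; elim: n => [|n IHn]; first by rewrite subn0 max_card.
have move_lt k (M : {set G}) : 0 < k -> M \subset unplayed (play s t n) ->
    #|M| = minn k #|unplayed (play s t n)| ->
    #|unplayed (play s t n) :\: M| <= #|G| - n.+1.
  move=> k0 sM cM; rewrite cardsD (setIidPr sM) cM subnS -subn1.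
  apply: leq_trans (leq_sub2r 1 IHn).
  have [->|U0] := posnP #|unplayed (play s t n)|; first by rewrite minn0.
  by apply: leq_sub2l; rewrite leq_min k0.
rewrite playS unplayedS; case: odd.
  by have [ut ct] := lt (play s t n); apply: (move_lt b).
by have [us cs] := ls (play s t n); apply: (move_lt a).
Qed.

Lemma eq_play (s t t' : strategy G) n :
  (forall h, size h < n -> t h = t' h) -> play s t n = play s t' n.
Proof.
elim: n => // n IHn ett'; rewrite !playS IHn => [|h /ltnW]; last exact: ett'.
by rewrite ett' ?size_play.
Qed.

(** Alice may win at a time [k] other than [n]. As colours only grow, a red vertex of [K] and a blue
    [K] would coexist at time [n + k], against disjointness. *)
Lemma alice_wins_no_blue_clique a (s t : strategy G) n K :
    legal a s -> legal 1 t -> alice_wins s t -> clique K ->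
  ~~ (K \subset blue (play s t n)).
Proof.
move=> ls lt [k /forallP/(_ K)] + cK; rewrite cK /= => /set0Pn[x].
rewrite inE => /andP[xK xR]; apply/negP => /subsetP/(_ x xK) xB.
have /pred0P/(_ x)/= := disjoint_play (n + k) ls lt.
rewrite (subsetP (subset_red_play s t k n)) // addnC.
by rewrite (subsetP (subset_blue_play s t n k)).
Qed.

(** * Altering strategies and completing moves to legal ones *)

Definition override (t : strategy G) h (M : {set G}) : strategy G :=
  fun h' => if h' == h then M else t h'.

Lemma override_legal b (t : strategy G) h (M : {set G}) :
    legal b t -> M \subset unplayed h -> #|M| = minn b #|unplayed h| ->
  legal b (override t h M).
Proof. by move=> lt sM cM h'; rewrite /override; case: eqP => [->|_]. Qed.

(** Legal moves have a prescribed size, so a smaller intended move [A] is padded with arbitrary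
    vertices of [U]. *)
Lemma exists_legal_move k (U A : {set G}) : A \subset U -> #|A| <= k ->
  exists A', [/\ A \subset A', A' \subset U & #|A'| = minn k #|U|].
Proof.
move=> sAU cA; have : minn k #|U| - #|A| <= #|U :\: A|.
  by rewrite cardsD (setIidPr sAU) leq_sub2r ?geq_minr.
case/card_geqP => r [ur sr rU].
exists (A :|: [set x in r]); split; first exact: subsetUl.
  rewrite subUset sAU; apply/subsetP => x; rewrite inE => /rU.
  by rewrite inE => /andP[].
have -> : #|A :|: [set x in r]| = #|A| + size r.
  rewrite cardsU disjoint_setI0 ?cards0 ?subn0 ?cardsE ?(card_uniqP ur) //.
  rewrite disjoint_sym disjoints_subset; apply/subsetP => x.
  by rewrite !inE => /rU; rewrite inE => /andP[].
by rewrite sr subnKC // leq_min cA subset_leq_card.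
Qed.

Lemma exists_legal k : exists t : strategy G, legal k t.
Proof.
have move_ex h : exists A : {set G},
    (A \subset unplayed h) && (#|A| == minn k #|unplayed h|).
  have [||A [_ sA cA]] := @exists_legal_move k (unplayed h) set0.
  - exact: sub0set.
  - by rewrite cards0.
  by exists A; rewrite sA cA /=.
exists (fun h => xchoose (move_ex h)) => h.
by have /andP[sM /eqP] := xchooseP (move_ex h).
Qed.

(** * Equivalence of winning strategies and safe regions *)

Lemma winning_safe a : alice_start_winning G a 1 -> safe a.
Proof.
case=> s ls win.
(* The positions reached by [s] against some legal Bob; [n] is odd because Bob is to move. *)
pose Q R B := exists t n, [/\ legal 1 t, odd n,
  R = red (play s t n) & B = blue (play s t n)].
have [t0 lt0] := exists_legal 1.
exists Q, (s [::]); split; first last.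
(* Bob has not moved yet, so any legal [t0] witnesses the opening position. *)
- by exists t0, 1; split; rewrite ?red_playS ?blue_playS //= /red /= setU0.
- by have [_ ->] := ls [::]; apply: geq_minl.
move=> R B [t [n [lt on -> ->]]]; split=> [K cK|m mU].
  by apply: alice_wins_no_blue_clique cK => //; apply: win.
(* Bob deviates only at the history [h]: the play up to [h] is unchanged and his next move is
   [m]. *)
set h := play s t n in mU *; pose t' := override t h [set m].
have lt' : legal 1 t'.
  have mU' : m \in unplayed h by rewrite inE.
  apply: override_legal; rewrite ?sub1set // cards1.
  by apply/esym/minn_idPl/card_gt0P; exists m.
have eh : play s t' n = h.
  apply: eq_play => h' sh'; rewrite /t' /override.
  by case: eqP sh' => // ->; rewrite /h size_play ltnn.
have th : t' h = [set m] by rewrite /t' /override eqxx.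
have bE : blue (play s t' n.+1) = m |: blue h by rewrite blue_playS on eh th.
have rE : red (play s t' n.+1) = red h by rewrite red_playS on eh.
have [sU sC] := ls (play s t' n.+1).
exists (s (play s t' n.+1)); split.
- rewrite -bE disjoints_subset (subset_trans sU) // setCS; exact: subsetUr.
- by rewrite sC geq_minl.
exists t', n.+2; split=> //; first by rewrite /= negbK.
  by rewrite red_playS /= on rE.
by rewrite blue_playS /= on bE.
Qed.

Lemma safe_winning a : 0 < a -> safe a -> alice_start_winning G a 1.
Proof.
move=> a0 [Q [A0 [safeQ cA0 QA0]]].
(* Alice must colour exactly a vertices, hence possibly more than Q asks for,
   so the actual red set is only required to contain that of a position in Q. *)
pose good R B := exists2 R' : {set G}, R' \subset R & Q R' B.
have [s0 ls0] := exists_legal a.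
pose fair h A := [&& A \subset unplayed h, #|A| == minn a #|unplayed h|
                   & `[< good (A :|: red h) (blue h) >]].
(* The fallback [s0] keeps [s] legal at histories where no fair move exists. *)
pose s h := odflt (s0 h) [pick A | fair h A].
have ls : legal a s.
  move=> h; rewrite /s; case: pickP => [A /and3P[sA /eqP cA _]|_] //.
  exact: ls0.
have s_good h (A R' : {set G}) : R' \subset A :|: red h -> Q R' (blue h) ->
    [disjoint A & blue h] -> #|A| <= a -> good (s h :|: red h) (blue h).
  move=> sR' QR' dA cA.
  (* The reply [A] avoids blue but may contain red vertices; the others are unplayed and get padded
     to a legal move. *)
  have [||A' [sA sA' cA']] := @exists_legal_move a (unplayed h) (A :\: red h).
  - rewrite /unplayed setCU setIC setDE; apply: setSI.
    by rewrite -disjoints_subset.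
  - by apply: leq_trans cA; apply/subset_leq_card/subsetDl.
  rewrite /s; case: pickP => [A1 /and3P[_ _ /asboolP] //|/(_ A')].
  rewrite /fair sA' cA' eqxx /=; case: asboolP => // + _; case.
  exists R' => //; apply: subset_trans sR' _; rewrite subUset subsetUr andbT.
  by rewrite setUC -subDset.
exists s => // t lt.
(* After [2n + 1] moves Alice has just played. *)
have goodn n : good (red (play s t n.*2.+1)) (blue (play s t n.*2.+1)).
  elim: n => [|n [R' sR' QR']].
    rewrite red_playS blue_playS /=; apply: (s_good _ A0 A0) => //.
      exact: subsetUl.
    by rewrite -setI_eq0 setI0.
  rewrite doubleS red_playS blue_playS /= odd_double /=.
  set h := play s t n.*2.+1 in sR' QR' *.
  have h_eq : play s t n.*2.+2 = t h :: h by rewrite playS /= odd_double.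
  have rE : red (play s t n.*2.+2) = red h by rewrite red_playS /= odd_double.
  have bE : blue (play s t n.*2.+2) = t h :|: blue h.
    by rewrite blue_playS /= odd_double.
  have [sM cM] := lt h.
  (* If Bob has nothing left to colour, the position [R'] of [Q] is kept and the empty reply
     suffices. *)
  have [M0|[m mM]] := set_0Vmem (t h).
    apply: (s_good _ set0 R'); rewrite ?set0U ?rE ?bE ?M0 ?set0U ?cards0 //.
    by rewrite -setI_eq0 set0I.
  have tm : t h = [set m].
    apply/esym/eqP; rewrite eqEcard sub1set mM cards1 cM; exact: geq_minl.
  have mU : m \notin R' :|: blue h.
    have := subsetP sM m mM; rewrite !inE !negb_or => /andP[mR ->].
    by rewrite andbT; apply: contra mR => /(subsetP sR').
  have [_ /(_ m mU)[A [dA cA QA]]] := safeQ _ _ QR'.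
  by apply: (s_good _ A (A :|: R')); rewrite ?rE ?bE ?tm // setUS.
(* An odd time, so that [goodn] applies, and late enough for the board to be full: a clique without
   red vertices would then be blue. *)
exists #|G|.*2.+1; have [R' _ /safeQ[noK _]] := goodn #|G|.
have U0 : unplayed (play s t #|G|.*2.+1) = set0.
  apply/eqP; rewrite -cards_eq0 -leqn0.
  apply: leq_trans (card_unplayed_play _ a0 (ltn0Sn 0) ls lt) _.
  by rewrite leqn0 subn_eq0 -addnn -addnS leq_addr.
apply/forallP => K; apply/implyP => /noK; apply: contraNneq => KR.
apply/subsetP => x xK; apply/negPn/negP => xB.
have xR : x \notin red (play s t #|G|.*2.+1).
  by apply/negP => xR; have := in_set0 x; rewrite -KR inE xK xR.
by have := in_set0 x; rewrite -U0 !inE negb_or xB xR.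
Qed.

Lemma a1_gt0 : 0 < a1 G.
Proof. by rewrite /a1; case: ex_minnP => a /andP[]. Qed.

Lemma a1_safe : safe (a1 G).
Proof.
by rewrite /a1; case: ex_minnP => a /andP[_ /asboolP/winning_safe].
Qed.

Lemma a1_le a : 0 < a -> safe a -> a1 G <= a.
Proof.
move=> a0 /(safe_winning a0) win; rewrite /a1; case: ex_minnP => k _; apply.
by rewrite a0; apply/asboolP.
Qed.

End Safety.

(** * Cliques and safety along an embedding onto a union of components *)

Section ComponentEmbedding.
Variables (G H : sgraph) (f : G -> H).
Hypothesis f_inj : injective f.
Hypothesis f_adj : forall x y, adj (f x) (f y) = adj x y.
Hypothesis f_closed : forall x y, adj (f x) y -> y \in codom f.

Lemma complete_imset (K : {set G}) : complete (f @: K) = complete K.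
Proof.
apply/forall_inP/forall_inP => cK x xK.
  apply/forall_inP => y yK; have /forall_inP := cK _ (imset_f f xK).
  by move/(_ _ (imset_f f yK)); rewrite (inj_eq f_inj) f_adj.
case/imsetP: xK => u uK ->; apply/forall_inP => _ /imsetP[v vK ->].
by rewrite (inj_eq f_inj) f_adj; apply: (forall_inP (cK u uK)).
Qed.

(** No edge leaves the image of [f], so a complete set meeting the image lies inside it. *)
Lemma complete_codom (L : {set H}) x :
  complete L -> f x \in L -> f @: (f @^-1: L) = L.
Proof.
move=> cL xL; apply/setP => y; apply/imsetP/idP => [[z + ->]|yL].
  by rewrite inE.
suff /codomP[z yz] : y \in codom f by exists z; rewrite // inE -yz.
have [->|nyx] := eqVneq y (f x); first exact: codom_f.
apply: (@f_closed x); have /forall_inP/(_ y yL) := forall_inP cL _ xL.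
by rewrite eq_sym nyx.
Qed.

(** A complete set containing [f @: K] meets the image because [K] is nonempty, hence is itself an
    image, and maximality of [K] applies. *)
Lemma clique_imset (K : {set G}) : clique K -> clique (f @: K).
Proof.
move=> cK; have /set0Pn[x xK] := clique_neq0 cK.
have /maxsetP[compK maxK] := cK; apply/maxsetP; rewrite complete_imset.
split=> // L cL sKL; have xL := subsetP sKL _ (imset_f f xK).
have LE := complete_codom cL xL; rewrite -LE (maxK (f @^-1: L)) //.
  by rewrite -complete_imset LE.
by rewrite -sub_imset_pre.
Qed.

Lemma clique_preimset (K : {set H}) x :
  clique K -> f x \in K -> clique (f @^-1: K).
Proof.
case/maxsetP=> cK maxK xK; have KE := complete_codom cK xK.
apply/maxsetP; rewrite -complete_imset KE; split=> // L.
rewrite -complete_imset => cL /(imsetS f); rewrite KE => sKL.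
by rewrite -(maxK _ cL sKL); apply/setP => z; rewrite inE mem_imset.
Qed.

Lemma safe_component a : safe H a -> safe G a.
Proof.
case=> Q [A0 [safeQ cA0 QA0]].
have le_pre (A : {set H}) : #|f @^-1: A| <= #|A|.
  rewrite -(card_imset _ f_inj); apply/subset_leq_card/subsetP.
  by move=> _ /imsetP[x + ->]; rewrite inE.
(* The blue set is exactly [f @: B], so Bob has played only inside the image; the red set [R'] may
   spill outside it. *)
pose Q' R (B : {set G}) := exists2 R' : {set H}, R = f @^-1: R' & Q R' (f @: B).
exists Q', (f @^-1: A0); split; first last.
- by exists A0; rewrite ?imset0.
- exact: leq_trans (le_pre A0) cA0.
move=> _ B [R -> /safeQ[noK resp]]; split=> [K cK|m mRB].
  by apply: contra (noK _ (clique_imset cK)) => /(imsetS f).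
have [|A [dA cA QA]] := resp (f m).
  by move: mRB; rewrite !inE mem_imset.
exists (f @^-1: A); split.
- rewrite disjoints_subset; apply/subsetP => x; rewrite !inE => xA.
  move: dA; rewrite disjoints_subset => /subsetP/(_ _ xA).
  by rewrite !inE (inj_eq f_inj) mem_imset.
- exact: leq_trans (le_pre A) cA.
by exists (A :|: R); rewrite ?preimsetU // imsetU1.
Qed.

End ComponentEmbedding.

(** * Safety of a disjoint union *)

Section Union.
Variables G1 G2 : sgraph.
Let f1 : G1 -> dunion G1 G2 := inl.
Let f2 : G2 -> dunion G1 G2 := inr.

Let f1_inj : injective f1. Proof. by move=> x y []. Qed.
Let f2_inj : injective f2. Proof. by move=> x y []. Qed.
Let f1_adj x y : adj (f1 x) (f1 y) = adj x y. Proof. by []. Qed.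
Let f2_adj x y : adj (f2 x) (f2 y) = adj x y. Proof. by []. Qed.
Let f1_closed x y : adj (f1 x) y -> y \in codom f1.
Proof. by case: y => // y _; apply: codom_f. Qed.
Let f2_closed x y : adj (f2 x) y -> y \in codom f2.
Proof. by case: y => // y _; apply: codom_f. Qed.

Lemma safe_dunionl a : safe (dunion G1 G2) a -> safe G1 a.
Proof. exact: (safe_component f1_inj f1_adj f1_closed). Qed.

Lemma safe_dunionr a : safe (dunion G1 G2) a -> safe G2 a.
Proof. exact: (safe_component f2_inj f2_adj f2_closed). Qed.

Let join (A1 : {set G1}) (A2 : {set G2}) : {set dunion G1 G2} :=
  f1 @: A1 :|: f2 @: A2.

Let f1_join A1 A2 x : (f1 x \in join A1 A2) = (x \in A1).
Proof.
rewrite inE mem_imset //; case: (x \in A1) => //=.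
by apply/imsetP => -[].
Qed.

Let f2_join A1 A2 x : (f2 x \in join A1 A2) = (x \in A2).
Proof.
rewrite inE orbC mem_imset //; case: (x \in A2) => //=.
by apply/imsetP => -[].
Qed.

Let card_join A1 A2 : #|join A1 A2| <= #|A1| + #|A2|.
Proof. by rewrite (leq_trans (leq_card_setU _ _)) // !card_imset. Qed.

Lemma safe_dunion a b : safe G1 a -> safe G2 b -> safe (dunion G1 G2) (a + b).
Proof.
case=> Q1 [A1 [safe1 cA1 QA1]] [Q2 [A2 [safe2 cA2 QA2]]].
pose Q (R B : {set dunion G1 G2}) :=
  Q1 (f1 @^-1: R) (f1 @^-1: B) /\ Q2 (f2 @^-1: R) (f2 @^-1: B).
exists Q, (join A1 A2); split; first last.
- split; rewrite preimset0.
    by rewrite (_ : _ @^-1: _ = A1) //; apply/setP=> x; rewrite inE f1_join.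
  by rewrite (_ : _ @^-1: _ = A2) //; apply/setP=> x; rewrite inE f2_join.
- exact: leq_trans (card_join _ _) (leq_add cA1 cA2).
move=> R B [Q1RB Q2RB].
have [noK1 resp1] := safe1 _ _ Q1RB; have [noK2 resp2] := safe2 _ _ Q2RB.
split=> [K cK|[m|m] mRB].
(* A clique of the union lies in one component and is a clique there, so that component's region
   prevents it from being blue. *)
- have /set0Pn[[x|x] xK] := clique_neq0 cK.
    have /noK1 := clique_preimset f1_inj f1_adj f1_closed cK xK.
    by apply: contra => /(preimsetS f1).
  have /noK2 := clique_preimset f2_inj f2_adj f2_closed cK xK.
  by apply: contra => /(preimsetS f2).
(* Bob played in [G1]: the reply is the one of [Q1], of size at most [a], and the trace on [G2] does
   not change. *)
- have [|A [dA cA QA]] := resp1 m; first by move: mRB; rewrite !inE.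
  exists (join A set0); split.
  + move: dA; rewrite !disjoints_subset => dA.
    apply/subsetP => -[x|x]; rewrite ?f1_join ?f2_join ?inE //.
    by move=> /(subsetP dA); rewrite !inE.
  + apply: leq_trans (card_join _ _) _.
    by rewrite cards0 addn0 (leq_trans cA) ?leq_addr.
  split.
    rewrite (_ : f1 @^-1: _ = A :|: f1 @^-1: R).
      rewrite (_ : f1 @^-1: (_ |: _) = m |: f1 @^-1: B) //.
      by apply/setP => x; rewrite !inE.
    by apply/setP => x; rewrite 2!inE f1_join !inE.
  rewrite (_ : f2 @^-1: _ = f2 @^-1: R).
    rewrite (_ : f2 @^-1: (_ |: _) = f2 @^-1: B) //.
    by apply/setP => x; rewrite !inE.
  by apply/setP => x; rewrite 2!inE f2_join !inE.
(* The symmetric case, with a reply in [G2] of size at most [b]. *)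
have [|A [dA cA QA]] := resp2 m; first by move: mRB; rewrite !inE.
exists (join set0 A); split.
- move: dA; rewrite !disjoints_subset => dA.
  apply/subsetP => -[x|x]; rewrite ?f1_join ?f2_join ?inE //.
  by move=> /(subsetP dA); rewrite !inE.
- apply: leq_trans (card_join _ _) _.
  by rewrite cards0 add0n (leq_trans cA) ?leq_addl.
split.
  rewrite (_ : f1 @^-1: _ = f1 @^-1: R).
    rewrite (_ : f1 @^-1: (_ |: _) = f1 @^-1: B) //.
    by apply/setP => x; rewrite !inE.
  by apply/setP => x; rewrite 2!inE f1_join !inE.
rewrite (_ : f2 @^-1: _ = A :|: f2 @^-1: R).
  rewrite (_ : f2 @^-1: (_ |: _) = m |: f2 @^-1: B) //.
  by apply/setP => x; rewrite !inE.
by apply/setP => x; rewrite 2!inE f2_join !inE.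
Qed.

End Union.

Theorem proposition3p1 (G1 G2 : sgraph) :
  maxn (a1 G1) (a1 G2) <= a1 (dunion G1 G2) <= a1 G1 + a1 G2.
Proof.
rewrite geq_max -andbA; apply/and3P; split.
- by apply: a1_le (a1_gt0 _) (safe_dunionl (a1_safe _)).
- by apply: a1_le (a1_gt0 _) (safe_dunionr (a1_safe _)).
apply: a1_le; first by rewrite addn_gt0 a1_gt0.
exact: safe_dunion (a1_safe _) (a1_safe _).
Qed.
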